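(* Let $X_Q=V(r^2-qs)\subset\mathbb{C}^4$ and for $d\in\mathbb{N}$ let $g_d:X_Q\to X_Q$ be the Chebyshev-induced morphism on $\mathbb{C}^3/D_4\simeq X_Q$. Let $S_A=V(A_h,\ qs-r^2)$ with $A_h=256-192p+48p^2-4p^3-128q-80pq+p^2q+16q^2+288r+36pr-8qr-108s$, and let $G_A:\mathbb{C}^2\to\mathbb{C}^4$, $$G_A(u,v)=\bigl(4+2uv+v^2,\ (u+2v)^2,\ (u+2v)(2u+4v+uv^2/2),\ (2u+4v+uv^2/2)^2\bigr).$$ Then for every $d\in\mathbb{N}$: (1) $g_d(G_A(u,v))=G_A(T_d(u),T_d(v))$ for all $u,v\in\mathbb{C}$; (2) $g_d(S_A)=S_A$.
   Context: $\mathbb{N}=\{1,2,\dots\}$. $T_d(z)$ is the one-variable Chebyshev polynomial with $T_d(s+s^{-1})=s^d+s^{-d}$. Definition of $g_d$: the Chebyshev endomorphism $P_{A_3}^d:\mathbb{C}^3\to\mathbb{C}^3$ is defined by $P_{A_3}^d(e_1(t),e_2(t),e_3(t))=(e_1(t^d),e_2(t^d),e_3(t^d))$ for $t=(t_1,t_2,t_3,t_4)\in(\mathbb{C}^* )^4$ with $t_1t_2t_3t_4=1$, where $t^d=(t_1^d,\dots,t_4^d)$ and $e_j$ is the $j$-th elementary symmetric polynomial. With $M_3(x,y,z)=(x+iy,\,z,\,x-iy)$ put $f_d=M_3^{-1}\circ P_{A_3}^d\circ M_3$. $D_4\subset GL(3,\mathbb{R})$ is the dihedral group of order 8 generated by $(x,y,z)\mapsto(-y,x,-z)$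 and $(x,y,z)\mapsto(x,-y,z)$. The map $\tilde F(x,y,z)=(x^2+y^2,\,z^2,\,z(x^2-y^2),\,(x^2-y^2)^2)$ from $\mathbb{C}^3$ onto $X_Q$ (coordinates $(p,q,r,s)$) induces a bijection $\mathbb{C}^3/D_4\simeq X_Q$, and $g_d:X_Q\to X_Q$ is the unique map with $g_d\circ\tilde F=\tilde F\circ f_d$ (it is a morphism). *)

(* Defs.v *)
From HB Require Import structures.
From mathcomp Require Import all_boot all_order all_algebra.
From mathcomp Require Import reals.
From mathcomp Require Import complex.
From mathcomp Require Import mpoly.
From mathcomp Require Import ring.

Set Implicit Arguments.
Unset Strict Implicit.
Unset Printing Implicit Defensive.

Import Order.TTheory GRing.Theory Num.Theory.
Local Open Scope ring_scope.

Section ChebyshevA3.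

Variable R : realType.
Notation C := R[i].

(* Normalised by T_d(s + 1/s) = s^d + 1/s^d, see chebyE; so T_0 = 2, T_1 = z. *)
Fixpoint cheby (d : nat) : {poly C} :=
  match d with
  | 0 => 2%:P
  | d1.+1 => match d1 with
             | 0 => 'X
             | d2.+1 => 'X * cheby d1 - cheby d2
             end
  end.

Lemma chebyE (d : nat) (s : C) :
  s != 0 -> (cheby d).[s + s^-1] = s ^+ d + s^-1 ^+ d.
Proof.
move=> s0; suff [] : (cheby d).[s + s^-1] = s ^+ d + s^-1 ^+ d
   /\ (cheby d.+1).[s + s^-1] = s ^+ d.+1 + s^-1 ^+ d.+1 by [].
elim: d => [|d [IH1 IH2]]; first by rewrite /= hornerC hornerX !expr0 !expr1.
split=> //; rewrite [cheby d.+2]/(('X * cheby d.+1 - cheby d)).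
rewrite hornerD hornerN hornerM hornerX IH1 IH2 !exprS.
have ss : s * s^-1 = 1 by rewrite divff.
have -> (x y : C) : (s + s^-1) * (s * x + s^-1 * y) - (x + y) =
   s * (s * x) + s^-1 * (s^-1 * y) + (s * s^-1 - 1) * (x + y) by ring.
by rewrite ss subrr mul0r addr0.
Qed.

Definition C2 : Type := (C * C)%type.
Definition C3 : Type := (C * C * C)%type.
Definition C4 : Type := (C * C * C * C)%type.

(* The condition t_1 t_2 t_3 t_4 = 1 already forces every t_j to be nonzero. *)
Definition torus (t : 4.-tuple C) : bool := \prod_(j < 4) tnth t j == 1.

Definition tpow (d : nat) (t : 4.-tuple C) : 4.-tuple C :=
  map_tuple (fun x => x ^+ d) t.

Definition elsym (j : nat) (t : 4.-tuple C) : C := (mesym 4 C j).@[tnth t].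

Definition e123 (t : 4.-tuple C) : C3 := (elsym 1 t, elsym 2 t, elsym 3 t).

Definition root_poly (t : 4.-tuple C) : {poly C} := \prod_(c <- t) ('X - c%:P).

Lemma elsym_coef (j : nat) (t : 4.-tuple C) :
  (j <= 4)%N -> elsym j t = (-1) ^+ j * (root_poly t)`_(4 - j).
Proof.
move=> j4; have := mroots_coeff t (Ordinal (j4 : (j < 5)%N)) => /= ->.
by rewrite mulrA -exprD addnn -mul2n exprM sqrrN expr1n expr1n mul1r.
Qed.

Lemma elsymE (j : nat) (t : 4.-tuple C) :
  elsym j t = \sum_(h : {set 'I_4} | #|h| == j) \prod_(i in h) tnth t i.
Proof.
rewrite /elsym /mesym raddf_sum; apply: eq_bigr => h _ /=.
by rewrite rmorph_prod; apply: eq_bigr => i _ /=; rewrite mevalXU.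
Qed.

Lemma elsym0 (t : 4.-tuple C) : elsym 0 t = 1.
Proof.
rewrite elsymE (big_pred1 set0); last by move=> h; rewrite cards_eq0.
by rewrite big_set0.
Qed.

Lemma elsym4 (t : 4.-tuple C) : elsym 4 t = \prod_(j < 4) tnth t j.
Proof.
rewrite elsymE (big_pred1 (setTfor _)).
  by apply: eq_bigl => i; rewrite !inE.
move=> h; rewrite /= [RHS]eqEcard subsetT /= cardsT card_ord eqn_leq.
by have := max_card h; rewrite card_ord => ->.
Qed.

Lemma size_root_poly (t : 4.-tuple C) : size (root_poly t) = 5.
Proof. by rewrite size_prod_XsubC size_tuple. Qed.

Lemma root_poly_eq (t t' : 4.-tuple C) :
  (forall j, (j <= 4)%N -> elsym j t = elsym j t') -> root_poly t = root_poly t'.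
Proof.
move=> E; apply/polyP => k; case: (leqP 5 k) => k5.
  by rewrite !nth_default ?size_root_poly.
have k4 : (4 - k <= 4)%N by rewrite leq_subr.
have := E _ k4; rewrite !elsym_coef // subKn //.
by move/mulfI; apply; rewrite signr_eq0.
Qed.

Lemma e123_perm (t t' : 4.-tuple C) :
  torus t -> torus t' -> e123 t = e123 t' -> perm_eq t t'.
Proof.
move=> /eqP t1 /eqP t1' [E1 E2 E3]; apply: prod_XsubC_eq; apply: root_poly_eq.
by case=> [|[|[|[|[|j]]]]] j4 //; rewrite ?elsym0 // !elsym4 t1 t1'.
Qed.

Lemma perm_e123 (t t' : 4.-tuple C) : perm_eq t t' -> e123 t = e123 t'.
Proof.
by move=> tt'; rewrite /e123 !elsym_coef // /root_poly (perm_big _ tt').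
Qed.

Lemma e123_onto (w : C3) : exists t : 4.-tuple C, torus t && (e123 t == w).
Proof.
case: w => [[a b] c]; set p : {poly C} := Poly [:: 1; - c; b; - a; 1].
have p0 : p = [:: 1; - c; b; - a; 1] :> seq C.
  by apply: (@PolyK _ 1); rewrite /= oner_eq0.
have [r] := closed_field_poly_normal p.
rewrite {1}/lead_coef p0 /= scale1r => pr.
have sr : size r == 4%N.
  by have := size_prod_XsubC r id; rewrite -pr p0 => -[->].
exists (Tuple sr).
have E j : (j <= 4)%N -> elsym j (Tuple sr) = (-1) ^+ j * p`_(4 - j).
  by move=> j4; rewrite elsym_coef // pr.
rewrite /torus -elsym4 /e123 !E // p0 /= !exprS expr0 !mulr1.
by rewrite !(mulNr, mulrN, mul1r, mulr1, opprK) !eqxx.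
Qed.

(* e123 t determines t up to permutation, so the value does not depend on the
   preimage chosen; see P_A3E. *)
Definition P_A3 (d : nat) (w : C3) : C3 :=
  e123 (tpow d (sval (sigW (e123_onto w)))).

Lemma P_A3E (d : nat) (t : 4.-tuple C) :
  torus t -> P_A3 d (e123 t) = e123 (tpow d t).
Proof.
move=> t1; rewrite /P_A3; case: sigW => t' /= /andP[t1' /eqP E].
by apply: perm_e123; apply: perm_map; apply: e123_perm.
Qed.

Definition M3 (w : C3) : C3 :=
  let: (x, y, z) := w in (x + 'i * y, z, x - 'i * y).

Definition M3inv (w : C3) : C3 :=
  let: (a, b, c) := w in ((a + c) / 2, (a - c) / (2 * 'i), b).

Lemma M3K : cancel M3 M3inv.
Proof.
move=> [[x y] z] /=; have i0 := @neq0Ci C.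
have n2 : (2 : C) != 0 by rewrite pnatr_eq0.
by congr (_, _, _); field; rewrite ?i0 ?n2.
Qed.

Lemma M3invK : cancel M3inv M3.
Proof.
move=> [[x y] z] /=; have i0 := @neq0Ci C.
have n2 : (2 : C) != 0 by rewrite pnatr_eq0.
by congr (_, _, _); field; rewrite ?i0 ?n2.
Qed.

Definition f_ (d : nat) (w : C3) : C3 := M3inv (P_A3 d (M3 w)).

Definition D4rot (w : C3) : C3 := let: (x, y, z) := w in (- y, x, - z).
Definition D4refl (w : C3) : C3 := let: (x, y, z) := w in (x, - y, z).

(* The generators have finite order, so inverses need not be added. *)
Inductive D4 : (C3 -> C3) -> Prop :=
| D4_id : D4 id
| D4_rot h : D4 h -> D4 (D4rot \o h)
| D4_refl h : D4 h -> D4 (D4refl \o h).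

Definition on_XQ (w : C4) : bool := let: (p, q, r, s) := w in r ^+ 2 - q * s == 0.

(* X_Q as a subtype of C^4; maps into X_Q carry the suffix X, the suffix-free
   versions Ftilde and G_A are the maps into C^4. *)
Definition XQ : Type := {w : C4 | on_XQ w}.

Definition Ftilde (w : C3) : C4 :=
  let: (x, y, z) := w in
  (x ^+ 2 + y ^+ 2, z ^+ 2, z * (x ^+ 2 - y ^+ 2), (x ^+ 2 - y ^+ 2) ^+ 2).

Lemma Ftilde_on_XQ (w : C3) : on_XQ (Ftilde w).
Proof. by case: w => [[x y] z]; apply/eqP; ring. Qed.

Definition FtildeX (w : C3) : XQ := exist _ (Ftilde w) (Ftilde_on_XQ w).

Lemma Ftilde_onto (w : XQ) : exists v : C3, FtildeX v == w.
Proof.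
case: w => [[[[p q] r] s] qw].
have /eqP := qw; rewrite /= => /eqP; rewrite subr_eq0 => /eqP rqs.
have n2 : (2 : C) != 0 by rewrite pnatr_eq0.
pose S (x : C) := sqrtC x.
have SK x : S x ^+ 2 = x by rewrite sqrtCK.
have [m [z [qz rz sm]]] : exists m z : C, [/\ z ^+ 2 = q, z * m = r & m ^+ 2 = s].
  have [q0|q0] := eqVneq q 0.
    exists (S s), 0; rewrite SK mul0r expr0n; split=> //.
    by apply/esym/eqP; rewrite -sqrf_eq0 rqs q0 mul0r.
  have z0 : S q != 0 by rewrite sqrtC_eq0.
  exists (r / S q), (S q); rewrite SK expr_div_n SK rqs; split=> //.
    by rewrite mulrC divfK.
  by rewrite mulrC mulKf.
exists (S ((p + m) / 2), S ((p - m) / 2), z); apply/eqP/val_inj => /=.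
rewrite !SK qz.
have -> : (p + m) / 2 - (p - m) / 2 = m by field.
by rewrite rz sm; congr (_, _, _, _); field.
Qed.

Lemma Ftilde_D4 (h : C3 -> C3) (v : C3) : D4 h -> FtildeX (h v) = FtildeX v.
Proof.
elim=> {h} [//|h _ IH|h _ IH]; rewrite -{}IH; apply: val_inj => /=;
  by case: (h v) => [[x y] z] /=; congr (_, _, _, _); ring.
Qed.

Lemma Ftilde_fiber (v v' : C3) : FtildeX v = FtildeX v' <-> exists2 h, D4 h & v' = h v.
Proof.
split=> [|[h Dh ->]]; last by rewrite Ftilde_D4.
case: v v' => [[x y] z] [[x' y'] z'] /(congr1 val) /= [E1 E2 E3 E4].
have n2 : (2 : C) != 0 by rewrite pnatr_eq0.
have sq (a b : C) : a ^+ 2 = b ^+ 2 -> a = b \/ a = - b.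
  by move=> /eqP; rewrite eqf_sqr => /orP[] /eqP; tauto.
have [[Em Ez]|[Em Ez]] : x ^+ 2 - y ^+ 2 = x' ^+ 2 - y' ^+ 2 /\ z = z' \/
    x ^+ 2 - y ^+ 2 = - (x' ^+ 2 - y' ^+ 2) /\ z = - z'.
- have [Em|Em] := sq _ _ E4; have [Ez|Ez] := sq _ _ E2; try tauto.
  + have [m0|m0] := eqVneq (x' ^+ 2 - y' ^+ 2) 0.
      by right; rewrite Em m0 oppr0.
    left; split=> //; move: E3; rewrite Em => /(mulIf m0) //.
  + have [m0|m0] := eqVneq (x' ^+ 2 - y' ^+ 2) 0.
      by left; rewrite Em m0 oppr0.
    right; split=> //; move: E3; rewrite Em mulrN -mulNr => /(mulIf m0) <-.
    by rewrite opprK.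
- have /sq Ex : x ^+ 2 = x' ^+ 2.
    have -> : x ^+ 2 = ((x ^+ 2 + y ^+ 2) + (x ^+ 2 - y ^+ 2)) / 2 by field.
    by rewrite E1 Em; field.
  have /sq Ey : y ^+ 2 = y' ^+ 2.
    have -> : y ^+ 2 = ((x ^+ 2 + y ^+ 2) - (x ^+ 2 - y ^+ 2)) / 2 by field.
    by rewrite E1 Em; field.
  rewrite {}Ez; case: Ex => ->; case: Ey => ->.
  + by exists id => //; constructor.
  + by exists (D4refl \o id); [do 2 constructor|rewrite /= opprK].
  + exists (D4rot \o (D4rot \o (D4refl \o id))); first by do 4 constructor.
    by rewrite /= !opprK.
  + exists (D4rot \o (D4rot \o id)); first by do 3 constructor.
    by rewrite /= !opprK.
- have /sq Ex : x ^+ 2 = y' ^+ 2.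
    have -> : x ^+ 2 = ((x ^+ 2 + y ^+ 2) + (x ^+ 2 - y ^+ 2)) / 2 by field.
    by rewrite E1 Em; field.
  have /sq Ey : y ^+ 2 = x' ^+ 2.
    have -> : y ^+ 2 = ((x ^+ 2 + y ^+ 2) - (x ^+ 2 - y ^+ 2)) / 2 by field.
    by rewrite E1 Em; field.
  rewrite {}Ez; case: Ex => ->; case: Ey => ->.
  + exists (D4rot \o (D4refl \o id)); first by do 3 constructor.
    by rewrite /= !opprK.
  + by exists (D4rot \o id); [do 2 constructor|rewrite /= !opprK].
  + exists (D4rot \o (D4rot \o (D4rot \o id))); first by do 4 constructor.
    by rewrite /= !opprK.
  + exists (D4refl \o (D4rot \o id)); first by do 3 constructor.
    by rewrite /= !opprK.
Qed.

Lemma elsymZ (c : C) (j : nat) (t : 4.-tuple C) :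
  elsym j (map_tuple ( *%R c) t) = c ^+ j * elsym j t.
Proof.
rewrite !elsymE mulr_sumr; apply: eq_bigr => h /eqP <-.
rewrite -prodr_const -big_split /=; apply: eq_bigr => i _.
by rewrite tnth_map.
Qed.

Lemma elsymV (j : nat) (t : 4.-tuple C) : torus t -> (j <= 4)%N ->
  elsym j (map_tuple GRing.inv t) = elsym (4 - j) t.
Proof.
move=> /eqP t1 j4; rewrite !elsymE (reindex_inj (@setC_inj _)) /=.
apply: eq_big => [h|h _].
  rewrite cardsCs setCK card_ord; have := max_card h; rewrite card_ord => h4.
  by rewrite -(eqn_add2r #|h|) subnK // eq_sym -[in RHS](eqn_add2r j) subnK // addnC.
have : \prod_(i in ~: h) tnth t i * \prod_(i in h) tnth t i = 1.
  rewrite -[RHS]t1 [RHS](bigID (fun i => i \in h)) /= [RHS]mulrC; congr (_ * _).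
  by apply: eq_bigl => i; rewrite inE.
have -> : \prod_(i in ~: h) tnth (map_tuple GRing.inv t) i
        = (\prod_(i in ~: h) tnth t i)^-1.
  by rewrite -prodfV; apply: eq_bigr => i _; rewrite tnth_map.
move=> E; have u0 : \prod_(i in ~: h) tnth t i != 0.
  apply/eqP => u0; move: E; rewrite u0 mul0r => /eqP.
  by rewrite eq_sym oner_eq0.
by apply: (mulfI u0); rewrite E mulfV.
Qed.

Lemma tpow_torus d t : torus t -> torus (tpow d t).
Proof.
move=> /eqP t1; apply/eqP; under eq_bigr do rewrite tnth_map.
by rewrite prodrXl t1 expr1n.
Qed.

Lemma e123Z (t : 4.-tuple C) : e123 (map_tuple ( *%R 'i) t) =
  ('i * (e123 t).1.1, - (e123 t).1.2, - 'i * (e123 t).2).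
Proof.
by rewrite /e123 !elsymZ expr1 sqrCi mulN1r exprS sqrCi mulrN1.
Qed.

Lemma e123V (t : 4.-tuple C) : torus t -> e123 (map_tuple GRing.inv t) =
  ((e123 t).2, (e123 t).1.2, (e123 t).1.1).
Proof. by move=> t1; rewrite /e123 !elsymV. Qed.

Lemma torusZ (t : 4.-tuple C) : torus t -> torus (map_tuple ( *%R 'i) t).
Proof.
by rewrite /torus -!elsym4 elsymZ -[4%N]/(2 * 2)%N exprM sqrCi sqrrN expr1n mul1r.
Qed.

Lemma torusV (t : 4.-tuple C) : torus t -> torus (map_tuple GRing.inv t).
Proof. by move=> t1; rewrite /torus -elsym4 elsymV // elsym0. Qed.

Lemma rot_step (d : nat) (a b c : C) :
  FtildeX (M3inv (('i ^+ d) ^+ 1 * a, ('i ^+ d) ^+ 2 * b, ('i ^+ d) ^+ 3 * c))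
    = FtildeX (M3inv (a, b, c)).
Proof.
elim: d => [|d <-]; first by rewrite expr0 !expr1n !mul1r.
rewrite -[RHS](@Ftilde_D4 (D4rot \o id)); last by do 2 constructor.
congr FtildeX; rewrite /= ['i ^+ d.+1]exprS; move: ('i ^+ d) => u.
have i2 : 'i ^+ 2 = -1 :> C by rewrite sqrCi.
have i3 : 'i ^+ 3 = - 'i :> C by rewrite exprS i2 mulrN1.
rewrite !['i * u]mulrC !exprMn i2 i3 invfM invCi.
congr (_, _, _); try ring.
apply/eqP; rewrite -subr_eq0; apply/eqP.
pose v : C := (u * a + u ^+ 3 * c) / 2.
transitivity (- ('i ^+ 2 + 1) * v); first by rewrite /v; ring.
by rewrite i2 addNr oppr0 mul0r.
Qed.

Lemma f_D4 (d : nat) (h : C3 -> C3) (v : C3) :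
  D4 h -> FtildeX (f_ d (h v)) = FtildeX (f_ d v).
Proof.
have step (k : C3 -> C3) w : D4 (k \o id) -> FtildeX (k w) = FtildeX w.
  exact: (@Ftilde_D4 (k \o id)).
elim=> {h} [//|h _ IH|h _ IH]; rewrite -{}IH /=; move: (h v) => {h}v;
  have /andP[t1 /eqP vt] := svalP (sigW (e123_onto (M3 v)));
  move: (sval _) t1 vt => t t1 vt; rewrite /f_ -[in RHS]vt P_A3E //.
- have -> : M3 (D4rot v) = e123 (map_tuple ( *%R 'i) t).
    rewrite e123Z vt; case: v {vt} => [[x y] z] /=.
    have i2 : 'i * 'i = -1 :> C by rewrite -expr2 sqrCi.
    by congr (_, _, _); rewrite ?mulNr ?(mulrDr, mulrBr, mulrN) ?mulrA ?i2; ring.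
  rewrite P_A3E ?torusZ //.
  have -> : tpow d (map_tuple ( *%R 'i) t) = map_tuple ( *%R ('i ^+ d)) (tpow d t).
    by apply/eq_from_tnth => j; rewrite !tnth_map exprMn.
  by rewrite /e123 !elsymZ rot_step.
- have -> : M3 (D4refl v) = e123 (map_tuple GRing.inv t).
    rewrite e123V // vt; case: v {vt} => [[x y] z] /=.
    by congr (_, _, _); ring.
  rewrite P_A3E ?torusV //.
  have -> : tpow d (map_tuple GRing.inv t) = map_tuple GRing.inv (tpow d t).
    by apply/eq_from_tnth => j; rewrite !tnth_map exprVn.
  rewrite e123V ?tpow_torus // -(@step D4refl); last by do 2 constructor.
  case: (e123 _) => [[a b] c] /=; congr FtildeX; rewrite /D4refl /M3inv.
  have i0 := @neq0Ci C; have n2 : (2 : C) != 0 by rewrite pnatr_eq0.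
  by congr (_, _, _); field; rewrite ?i0 ?n2.
Qed.

(* Well defined on the quotient by Ftilde_fiber and f_D4; characterised by g_Ftilde and
   g_unique. *)
Definition g_ (d : nat) (w : XQ) : XQ := FtildeX (f_ d (sval (sigW (Ftilde_onto w)))).

Lemma g_Ftilde (d : nat) (v : C3) : g_ d (FtildeX v) = FtildeX (f_ d v).
Proof.
rewrite /g_; case: sigW => v' /= /eqP /esym /Ftilde_fiber [h Dh ->].
exact: f_D4.
Qed.

Lemma g_unique (d : nat) (g : XQ -> XQ) :
  (forall v, g (FtildeX v) = FtildeX (f_ d v)) -> g =1 g_ d.
Proof.
by move=> gE w; have [v /eqP <-] := Ftilde_onto w; rewrite gE g_Ftilde.
Qed.

Definition G_A (w : C2) : C4 :=
  let: (u, v) := w in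
  (4 + 2 * u * v + v ^+ 2,
   (u + 2 * v) ^+ 2,
   (u + 2 * v) * (2 * u + 4 * v + u * v ^+ 2 / 2),
   (2 * u + 4 * v + u * v ^+ 2 / 2) ^+ 2).

Lemma G_A_on_XQ (w : C2) : on_XQ (G_A w).
Proof. by case: w => [u v]; apply/eqP; ring. Qed.

Definition G_AX (w : C2) : XQ := exist _ (G_A w) (G_A_on_XQ w).

Definition A_h (w : C4) : C :=
  let: (p, q, r, s) := w in
  256 - 192 * p + 48 * p ^+ 2 - 4 * p ^+ 3 - 128 * q - 80 * p * q
  + p ^+ 2 * q + 16 * q ^+ 2 + 288 * r + 36 * p * r - 8 * q * r - 108 * s.

End ChebyshevA3.

From mathcomp Require Import classical_sets.

Definition S_A (R : realType) : set (C4 R) :=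
  [set w | A_h w = 0 /\ (let: (p, q, r, s) := w in q * s - r ^+ 2 = 0)]%classic.

(* Main.v *)
Require Import Defs.
From mathcomp Require Import all_boot all_order all_algebra.
From mathcomp Require Import classical_sets reals complex.
From mathcomp Require Import ring.

Set Implicit Arguments.
Unset Strict Implicit.
Unset Printing Implicit Defensive.

Import GRing.Theory Num.Theory.
Local Open Scope classical_set_scope.
Local Open Scope ring_scope.

(** S_A is the image of the discriminant locus of the quartics with roots
    t_1, ..., t_4: for t = (a, a, w/a, 1/(w a)) and s = a^2, the quotient map sends
    e(t) to G_A(s + 1/s, w + 1/w), and raising t to the power d replaces (s, w)
    by (s^d, w^d); this is (1).  Moreover S_A is exactly the image of G_A, and T_d
    is onto, so (2) follows from (1).  To invert G_A on a point (p, b^2, b m, m^2),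
    solve p = 4 + 2 u v + v^2 and b = u + 2 v: this is a quadratic equation for v,
    and A_h is, up to a constant, its resultant with the cubic equation
    expressing m. *)

(** The roots of X^2 - z X + 1 have product 1, so the root [z - s] is the inverse of the root
    [s]. *)
Lemma add_inv_onto (C : numClosedFieldType) (z : C) :
  exists2 s, s != 0 & z = s + s^-1.
Proof.
pose r := sqrtC (z ^+ 2 - 4); pose s := (z + r) / 2.
have n2 : (2 : C) != 0 by rewrite pnatr_eq0.
have rE : r ^+ 2 = z ^+ 2 - 4 by rewrite sqrtCK.
have ss : s * (z - s) = 1.
  transitivity ((z ^+ 2 - r ^+ 2) / 4); first by rewrite /s; field.
  by rewrite rE; field.
have s0 : s != 0 by apply: contra_eq_neq ss => ->; rewrite mul0r eq_sym oner_neq0.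
by exists s => //; rewrite -[s^-1]mulr1 -ss mulKf // addrC subrK.
Qed.

Section Chebyshev.

Variable R : realType.
Notation C := R[i].

(** With z = s + 1/s, a d-th root of [s] yields the preimage by [chebyE]. *)
Lemma cheby_onto (d : nat) (z : C) : (0 < d)%N -> exists x, (cheby R d).[x] = z.
Proof.
move=> d0; have [s s0 ->] := add_inv_onto z.
have r0 : d.-root s != 0 by rewrite rootC_eq0.
by exists (d.-root s + (d.-root s)^-1); rewrite chebyE // exprVn rootCK.
Qed.

Lemma e123E (a b c e : C) : e123 [tuple a; b; c; e] =
  (a + b + c + e, a * b + a * c + a * e + b * c + b * e + c * e,
   a * b * c + a * b * e + a * c * e + b * c * e).
Proof.
have rE : root_poly [tuple a; b; c; e] = 'X^4 - (a + b + c + e) *: 'X^3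
    + (a * b + a * c + a * e + b * c + b * e + c * e) *: 'X^2
    - (a * b * c + a * b * e + a * c * e + b * c * e) *: 'X + (a * b * c * e)%:P.
  rewrite /root_poly !big_cons big_nil -!mul_polyC !rmorphD /= !rmorphM /=; ring.
rewrite /e123 !elsym_coef // rE !(coefD, coefN, coefZ, coefXn, coefX, coefC) /=.
by congr (_, _, _); ring.
Qed.

(* In the quotient coordinates, p = e_1 e_3, and (q, r, s) = (z^2, z m, m^2) with
   z = e_2 and m = x^2 - y^2 = (e_1^2 + e_3^2) / 2. *)
Lemma Ftilde_M3inv (a b c : C) : Ftilde (M3inv (a, b, c)) =
  (a * c, b ^+ 2, b * ((a ^+ 2 + c ^+ 2) / 2), ((a ^+ 2 + c ^+ 2) / 2) ^+ 2).
Proof.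
have n2 : (2 : C) != 0 by rewrite pnatr_eq0.
have yE : ((a - c) / (2 * 'i)) ^+ 2 = - ((a - c) / 2) ^+ 2.
  by rewrite !expr_div_n exprMn sqrCi mulrN1 invrN mulrN.
by rewrite /= yE; congr (_, _, _, _); field.
Qed.

Definition double_root_tuple (a w : C) : 4.-tuple C := [tuple a; a; w / a; (w * a)^-1].

Lemma double_root_torus (a w : C) : a != 0 -> w != 0 -> torus (double_root_tuple a w).
Proof.
move=> a0 w0; apply/eqP; rewrite !big_ord_recl big_ord0 /= !(tnth_nth 0) /=.
by field; rewrite a0 w0.
Qed.

Lemma Ftilde_double_root (a w : C) : a != 0 -> w != 0 ->
  Ftilde (M3inv (e123 (double_root_tuple a w)))
  = G_A (a ^+ 2 + (a ^+ 2)^-1, w + w^-1).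
Proof.
move=> a0 w0; rewrite e123E Ftilde_M3inv /=.
by congr (_, _, _, _); field; rewrite a0 w0.
Qed.

Lemma g_G_A (d : nat) (u v : C) :
  sval (g_ d (G_AX (u, v))) = G_A ((cheby R d).[u], (cheby R d).[v]).
Proof.
have [s s0 ->] := add_inv_onto u; have [w w0 ->] := add_inv_onto v.
pose a := sqrtC s; have aE : a ^+ 2 = s by rewrite sqrtCK.
have a0 : a != 0 by rewrite sqrtC_eq0.
have t1 := double_root_torus a0 w0.
have -> : G_AX (s + s^-1, w + w^-1) = FtildeX (M3inv (e123 (double_root_tuple a w))).
  by apply: val_inj; rewrite [RHS]Ftilde_double_root // aE.
rewrite g_Ftilde /f_ M3invK P_A3E // !chebyE //.
have -> : tpow d (double_root_tuple a w) = double_root_tuple (a ^+ d) (w ^+ d).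
  by apply: val_inj; rewrite /= exprMn !exprVn exprMn.
by rewrite [LHS]Ftilde_double_root ?expf_neq0 // -!exprM mulnC exprM aE !exprVn.
Qed.

Lemma S_A_G_A (z : C * C) : S_A (G_A z).
Proof.
have n2 : (2 : C) != 0 by rewrite pnatr_eq0.
by case: z => u v; split=> /=; field.
Qed.

Lemma G_A_onto (w : XQ R) : S_A (sval w) -> exists z : C * C, w = G_AX z.
Proof.
(* A preimage under [Ftilde] supplies compatible square roots: q = b^2, s = m^2 and r = b m, where m
   = x^2 - y^2. *)
have [[[x y] b] /eqP <-] := Ftilde_onto w.
have n2 : (2 : C) != 0 by rewrite pnatr_eq0.
have n3 : (3 : C) != 0 by rewrite pnatr_eq0.
move=> [+ _]; rewrite /A_h /=.
have [p pE] : exists p : C, x ^+ 2 + y ^+ 2 = p by exists (x ^+ 2 + y ^+ 2).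
have [m mE] : exists m : C, x ^+ 2 - y ^+ 2 = m by exists (x ^+ 2 - y ^+ 2).
rewrite pE mE.
(* Substituting u = b - 2 v in p = 4 + 2 u v + v^2 gives 3 v^2 - 2 b v + p - 4 = 0, with roots [v1]
   and [v2] below. *)
pose r := sqrtC (b ^+ 2 - 3 * (p - 4)).
have rE : r ^+ 2 = b ^+ 2 - 3 * (p - 4) by rewrite sqrtCK.
(* With u = b - 2 v, [f v = 0] says m = 2 u + 4 v + u v^2 / 2. *)
pose f v := 2 * v ^+ 3 - b * v ^+ 2 + 2 * m - 4 * b.
pose v1 := (b + r) / 3; pose v2 := (b - r) / 3.
have bE : b = 3 * (v1 + v2) / 2 by rewrite /v1 /v2; field.
have pE' : p = 4 + 3 * (v1 * v2).
  transitivity (4 + (b ^+ 2 - r ^+ 2) / 3); last by rewrite /v1 /v2; field.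
  by rewrite rE; field.
have sol v : f v = 0 -> p = 4 + 2 * b * v - 3 * v ^+ 2 ->
    exists z : C * C, FtildeX (x, y, b) = G_AX z.
  move=> fv pv; exists (b - 2 * v, v); apply: val_inj; rewrite /= pE mE.
  have mv : m = 2 * (b - 2 * v) + 4 * v + (b - 2 * v) * v ^+ 2 / 2.
    transitivity (f v / 2 + (2 * (b - 2 * v) + 4 * v + (b - 2 * v) * v ^+ 2 / 2)).
      by rewrite /f; field.
    by rewrite fv mul0r add0r.
  by rewrite -mv; congr (_, _, _, _); rewrite ?pv; ring.
(* The resultant as a product over the roots: [A_h] vanishes iff the cubic [f] vanishes at [v1] or
   [v2]. Vieta's relations [bE] and [pE'] eliminate [r]. *)
have -> : 256 - 192 * p + 48 * p ^+ 2 - 4 * p ^+ 3 - 128 * b ^+ 2 - 80 * p * b ^+ 2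
    + p ^+ 2 * b ^+ 2 + 16 * (b ^+ 2) ^+ 2 + 288 * (b * m) + 36 * p * (b * m)
    - 8 * b ^+ 2 * (b * m) - 108 * m ^+ 2 = - 27 * (f v1 * f v2).
  by rewrite /f pE' bE; field.
move=> /eqP; rewrite !mulf_eq0 oppr_eq0 pnatr_eq0 /= => /orP[] /eqP fv; apply: sol fv _;
  by rewrite pE' bE; field.
Qed.

End Chebyshev.

Theorem theorem4p22 (R : realType) (d : nat) (hd : (0 < d)%N) :
  (forall u v : R[i],
     sval (g_ d (G_AX (u, v))) = G_A ((cheby R d).[u], (cheby R d).[v]))
  /\ [set sval (g_ d w) | w in [set w : XQ R | S_A (sval w)]] = S_A (R := R).
Proof.
split=> [u v|]; first exact: g_G_A.
rewrite eqEsubset; split=> [_ [w /G_A_onto [[u v] ->] <-]|w wS].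
  by rewrite g_G_A; apply: S_A_G_A.
have wX : on_XQ w.
  case: w wS => [[[p q] r] s] [_ /eqP]; rewrite subr_eq0 => /eqP E.
  by rewrite /on_XQ E subrr.
have [[u v] /(congr1 sval) wE] := @G_A_onto R (exist _ w wX) wS.
(* By (1), preimages of [u] and [v] under T_d give a preimage of the point under g_d. *)
have [x xu] := cheby_onto u hd; have [y yv] := cheby_onto v hd.
by exists (G_AX (x, y)); [apply: S_A_G_A | apply: etrans (g_G_A _ _ _) _; rewrite xu yv].
Qed.
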